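(* Let $\{X_t;\,t\ge 0\}$ be a simple bilateral birth--and--death process on $\mathbf{Z}$ with birth rates $\lambda_n>0$ and death rates $\mu_n>0$ ($n\in\mathbf{Z}$), and let $p_{k,n}(t)=\Pr\{X_t=n\mid X_0=k\}$ denote its transition probabilities. Let $\{\ldots,\nu_{-1},\nu_0,\nu_1,\ldots\}$ be a strictly monotonic sequence of positive numbers satisfying $$\nu_{n+1}\lambda_n-\nu_n(\lambda_n+\mu_n)+\nu_{n-1}\mu_n=0\qquad\text{for all } n\in\mathbf{Z}.$$ If a bilateral birth--and--death process $\widetilde X_t$ on $\mathbf{Z}$ has birth rates $\widetilde\lambda_n$ and death rates $\widetilde\mu_n$ given by $$\widetilde\lambda_n=\lambda_n\,\frac{\nu_{n+1}}{\nu_n},\qquad \widetilde\mu_n=\mu_n\,\frac{\nu_{n-1}}{\nu_n}\qquad(n\in\mathbf{Z}),$$ then its transition probabilities $\widetilde p_{k,n}(t)=\Pr\{\widetilde X_t=n\mid\widetilde X_0=k\}$ are given, for all $t\ge 0$, by $$\widetilde p_{k,n}(t)=\frac{\nu_n}{\nu_k}\,p_{k,n}(t)\qquad(k,n\in\mathbf{Z}).$$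
   Context: A bilateral birth--and--death process is a birth--and--death process $\{X_t;\,t\ge0\}$ with state space the set of all integers $\mathbf{Z}=\{\ldots,-1,0,1,\ldots\}$ whose birth rates $\lambda_n=\lim_{\delta\downarrow0}\frac1\delta\Pr\{X_{t+\delta}=n+1\mid X_t=n\}$ and death rates $\mu_n=\lim_{\delta\downarrow0}\frac1\delta\Pr\{X_{t+\delta}=n-1\mid X_t=n\}$ are positive for every $n\in\mathbf{Z}$ (so there are no absorbing or reflecting states). The process is called simple if its set of rates $\{\lambda_n,\mu_n\}$ uniquely determines the birth--and--death process; in that case, for each initial state $k\in\mathbf{Z}$, the transition probabilities $p_{k,n}(t)$ are the unique solution of the forward system $$\frac{d}{dt}p_{k,n}(t)=\lambda_{n-1}\,p_{k,n-1}(t)-(\lambda_n+\mu_n)\,p_{k,n}(t)+\mu_{n+1}\,p_{k,n+1}(t)\qquad(n\in\mathbf{Z})$$ with initial conditions $p_{k,n}(0)=1$ if $n=k$ and $p_{k,n}(0)=0$ if $n\ne k$.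
   Formalization: ''Simple'' is taken to mean that the rates determine the process and also that the transition probabilities are the unique solution of the forward system among all nonnegative solutions; with uniqueness only among probability solutions the claim fails, since the transformed process may explode. *)

(* Defs.v *)
From HB Require Import structures.
From mathcomp Require Import all_boot all_order all_algebra.
From mathcomp Require Import all_classical all_reals all_analysis.

Set Implicit Arguments.
Unset Strict Implicit.
Unset Printing Implicit Defensive.

Import Order.TTheory GRing.Theory Num.Theory.
Import numFieldNormedType.Exports.

Local Open Scope classical_set_scope.
Local Open Scope ring_scope.

(* A process with state space Z is a family X of maps Omega -> int indexed by
   the times t >= 0 (values at negative times are never used), together with a
   family of laws Pr : int -> probability Omega R, where Pr k stands for
   Pr{ . | X_0 = k}. *)

(* Junk value 0 when P B = 0. *)
Definition cond_prob (R : realType) (d : measure_display)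
    (Omega : measurableType d) (P : probability Omega R) (A B : set Omega) : R :=
  fine (P (A `&` B)) / fine (P B).

Definition at_state (R : realType) (d : measure_display)
    (Omega : measurableType d) (X : R -> Omega -> int) (t : R) (n : int) :
    set Omega :=
  [set w | X t w = n].

(* The event that X_s = m for every pair (s, m) in the list h. *)
Definition history (R : realType) (d : measure_display)
    (Omega : measurableType d) (X : R -> Omega -> int) (h : seq (R * int)) :
    set Omega :=
  [set w | forall e, e \in h -> X e.1 w = e.2].

(* p_{k,n}(t) = Pr{X_t = n | X_0 = k}. *)
Definition trans_prob (R : realType) (d : measure_display)
    (Omega : measurableType d) (Pr : int -> probability Omega R)
    (X : R -> Omega -> int) (k n : int) (t : R) : R :=
  fine (Pr k (at_state X t n)).

Definition is_markov_process (R : realType) (d : measure_display)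
    (Omega : measurableType d) (Pr : int -> probability Omega R)
    (X : R -> Omega -> int) : Prop :=
  [/\ forall (t : R) (n : int), 0 <= t -> measurable (at_state X t n),
      forall k : int, Pr k (at_state X 0 k) = 1%E
    & forall (k i j : int) (h : seq (R * int)) (t s : R),
        0 <= t -> 0 <= s -> (forall e, e \in h -> 0 <= e.1 <= t) ->
        (0 < Pr k (history X h `&` at_state X t i))%E ->
        cond_prob (Pr k) (at_state X (t + s) j)
                  (history X h `&` at_state X t i) = trans_prob Pr X i j s].

(* The rates are the right derivatives, at every time t, of the conditional
   probabilities given X_t = n.  The last limit says that only transitions to
   nearest neighbours have a nonzero rate; as total mass is 1, it gives
   Pr{X_(t+dl) = n | X_t = n} = 1 - (lam n + mu n) dl + o(dl).
   No regularity of the paths is required. *)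
Definition is_bilateral_bd_process (R : realType) (d : measure_display)
    (Omega : measurableType d) (Pr : int -> probability Omega R)
    (X : R -> Omega -> int) (lam mu : int -> R) : Prop :=
  [/\ is_markov_process Pr X,
      forall n : int, 0 < lam n,
      forall n : int, 0 < mu n
    & forall (k n : int) (t : R), 0 <= t -> (0 < Pr k (at_state X t n))%E ->
      [/\ dl^-1 * cond_prob (Pr k) (at_state X (t + dl) (n + 1))
                            (at_state X t n) @[dl --> 0^'+] --> lam n,
          dl^-1 * cond_prob (Pr k) (at_state X (t + dl) (n - 1))
                            (at_state X t n) @[dl --> 0^'+] --> mu n
        & dl^-1 * cond_prob (Pr k)
                    (~` (at_state X (t + dl) (n - 1) `|` at_state X (t + dl) n
                         `|` at_state X (t + dl) (n + 1)))
                    (at_state X t n) @[dl --> 0^'+] --> (0 : R)]].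

Definition rates_determine_process (R : realType) (lam mu : int -> R) : Prop :=
  forall (d1 d2 : measure_display)
         (Omega1 : measurableType d1) (Omega2 : measurableType d2)
         (Pr1 : int -> probability Omega1 R) (Pr2 : int -> probability Omega2 R)
         (X1 : R -> Omega1 -> int) (X2 : R -> Omega2 -> int),
    is_bilateral_bd_process Pr1 X1 lam mu ->
    is_bilateral_bd_process Pr2 X2 lam mu ->
    forall (k n : int) (t : R), 0 <= t ->
      trans_prob Pr1 X1 k n t = trans_prob Pr2 X2 k n t.

(* f solves the forward system on [0, +oo) started from k; right continuity at
   t = 0 ties the initial condition to the equations on t > 0, which then also
   hold at t = 0 with a right derivative. *)
Definition forward_solution (R : realType) (lam mu : int -> R) (k : int)
    (f : int -> R -> R) : Prop :=
  [/\ forall n : int, f n 0 = (n == k)%:R,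
      forall n : int, f n t @[t --> 0^'+] --> f n 0
    & forall (n : int) (t : R), 0 < t ->
        is_derive t 1 (f n)
          (lam (n - 1) * f (n - 1) t - (lam n + mu n) * f n t
           + mu (n + 1) * f (n + 1) t)].

(* Uniqueness has to be restricted to nonnegative solutions: among arbitrary
   real families it fails for all rates, since f_0 and f_1 may be perturbed by
   functions that are flat at 0 and the system solved recursively in n.  No bound on the total mass of f is
   imposed; with \sum_n f n t <= 1, uniqueness would only mean non-explosion, and
   would not exclude solutions with mass fed in from an entrance boundary. *)
Definition unique_forward_solution (R : realType) (lam mu : int -> R) (k : int)
    (p : int -> R -> R) : Prop :=
  forward_solution lam mu k p /\
  forall f : int -> R -> R,
    forward_solution lam mu k f ->
    (forall (n : int) (t : R), 0 <= t -> 0 <= f n t) ->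
    forall (n : int) (t : R), 0 <= t -> f n t = p n t.

Definition is_simple_bilateral_bd_process (R : realType) (d : measure_display)
    (Omega : measurableType d) (Pr : int -> probability Omega R)
    (X : R -> Omega -> int) (lam mu : int -> R) : Prop :=
  [/\ is_bilateral_bd_process Pr X lam mu,
      rates_determine_process lam mu
    & forall k : int, unique_forward_solution lam mu k (trans_prob Pr X k)].

Definition strictly_monotonic (R : realType) (nu : int -> R) : Prop :=
  {homo nu : m n / m < n} \/ {homo nu : m n / m < n >-> n < m}.

(* Main.v *)
(* A process with rates [lam', mu'] satisfies the backward system: in a short time h
   it either stays, or makes one step, up to an error o(h), and this expansion at
   time 0 combined with the Markov property gives both one-sided derivatives of
   p'_{k,n} at every time.  Let pi be the reversing measure, pi_k lam_k =
   pi_(k+1) mu_(k+1).  The measure pi_k nu_k^2 reverses the transformed rates, so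
   reversal turns the backward system for p'_{k,n} in the initial state k into the
   statement that k |-> pi_k nu_k p'_{k,n} / (pi_n nu_n) solves the forward system
   for [lam, mu] started from n.  It is nonnegative, hence equals p_{n,k} by
   uniqueness.  The case nu = 1 gives pi_k p_{k,n} / pi_n = p_{n,k}, and comparing
   the two identities yields the claim. *)

Require Import Defs.
From mathcomp Require Import all_boot all_order all_algebra.
From mathcomp Require Import all_classical all_reals all_analysis.
From mathcomp Require Import ring lra zify.

Set Implicit Arguments.
Unset Strict Implicit.
Unset Printing Implicit Defensive.

Import Order.TTheory GRing.Theory Num.Theory.
Import numFieldNormedType.Exports.

Local Open Scope classical_set_scope.
Local Open Scope ring_scope.

(** * Recurrences on the integers, one-sided limits and derivatives *)

Lemma int_recurrence_pos (R : realType) (rho : int -> R) :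
  (forall n, 0 < rho n) ->
  exists2 p : int -> R, (forall n, 0 < p n) &
    forall n, p (n + 1) = rho n * p n.
Proof.
move=> rho_gt0.
(* Normalised by [p 0 = 1]. Since [Negz m] is [-(m+1)], its value is reached by dividing by [rho] at
   [-1, ..., -(m+1)], hence [m.+1] factors. *)
pose p (n : int) : R := match n with
  | Posz m => \prod_(i < m) rho i%:Z
  | Negz m => \prod_(i < m.+1) (rho (- i.+1%:Z))^-1 end.
exists p => [[m|m]|[m|[|m]]].
- exact: prodr_gt0.
- by apply: prodr_gt0 => i _; rewrite invr_gt0.
- have -> : Posz m + 1 = Posz m.+1 by lia.
  by rewrite /p big_ord_recr /= mulrC.
- have -> : Negz 0 + 1 = 0 by lia.
  by rewrite /p [in RHS]big_ord_recr !big_ord0 /= mul1r NegzE mulfV ?gt_eqF.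
- have -> : Negz m.+1 + 1 = Negz m by lia.
  by rewrite /p [in RHS]big_ord_recr /= NegzE mulrCA mulfV ?mulr1 ?gt_eqF.
Qed.

Lemma cvg_at_right0_of_quotient (R : realType) (g : R -> R) (l : R) :
  h^-1 * g h @[h --> 0^'+] --> l -> g h @[h --> 0^'+] --> 0.
Proof.
move=> gl.
have h0 : (h : R) @[h --> 0^'+] --> (0 : R) by exact: cvg_at_right_filter.
rewrite -[X in _ --> X](mul0r l); apply: (cvg_trans _ (cvgM h0 gl)).
apply: near_eq_cvg; near=> h.
by rewrite /= mulVKf ?gt_eqF.
Unshelve. all: by end_near. Qed.

Lemma cvg_at_right0_of_dist_le (R : realType) (f c : R -> R) (l : R) :
  (\forall h \near 0^'+, `|f h - l| <= c h) -> c h @[h --> 0^'+] --> 0 ->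
  f h @[h --> 0^'+] --> l.
Proof.
move=> fc c0; apply/cvgrPdist_le => e e0.
have /cvgrPdist_le/(_ _ e0) ce := c0.
near=> h.
have h1 : `|f h - l| <= c h by near: h.
have h2 : `|0 - c h| <= e by near: h.
rewrite distrC (le_trans h1)// (le_trans _ h2)// sub0r normrN.
exact: ler_norm.
Unshelve. all: by end_near. Qed.

Lemma is_derive_two_sided (R : realType) (f : R -> R) (x l : R) :
  h^-1 * (f (x + h) - f x) @[h --> 0^'+] --> l ->
  h^-1 * (f x - f (x - h)) @[h --> 0^'+] --> l ->
  is_derive x 1 f l.
Proof.
move=> fr fl.
have fl0 : h^-1 * (f (h * 1 + x) - f x) @[h --> 0^'] --> l.
  apply: (@cvg_at_right_left_dnbhs R R^o).
    apply: (cvg_trans _ fr); apply: near_eq_cvg; near=> h.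
    by rewrite /= mulr1 (addrC h).
  apply/cvg_at_leftNP; rewrite oppr0.
  apply: (cvg_trans _ fl); apply: near_eq_cvg; near=> h.
  by rewrite /= mulr1 (addrC _ x) invrN mulNr -mulrN opprB.
apply: DeriveDef; first by apply/cvg_ex; exists l.
exact: cvg_lim.
Unshelve. all: by end_near. Qed.

(** The error bound [r h] does not depend on [s], so the expansion may be used with a base point
    that moves with [h]: [s = t] gives the right derivative and [s = t - h] the left one. In the
    latter case left continuity of [u], [v], [w] identifies the limit. *)
Lemma is_derive_of_one_step (R : realType) (u v w a b r : R -> R) (la lb t : R) :
  0 < t ->
  (forall s h, 0 <= s -> 0 <= h ->
     `|u (s + h) - u s - (a h * (v s - u s) + b h * (w s - u s))| <= r h) ->
  h^-1 * a h @[h --> 0^'+] --> la ->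
  h^-1 * b h @[h --> 0^'+] --> lb ->
  h^-1 * r h @[h --> 0^'+] --> 0 ->
  u (t - h) @[h --> 0^'+] --> u t ->
  v (t - h) @[h --> 0^'+] --> v t ->
  w (t - h) @[h --> 0^'+] --> w t ->
  is_derive t 1 u (la * (v t - u t) + lb * (w t - u t)).
Proof.
move=> t0 step al bl r0 ul vl wl.
have quot (s : R -> R) (d : R -> R) :
    u (s h) @[h --> 0^'+] --> u t ->
    v (s h) @[h --> 0^'+] --> v t ->
    w (s h) @[h --> 0^'+] --> w t ->
    (\forall h \near 0^'+, 0 <= s h /\ d h = u (s h + h) - u (s h)) ->
    h^-1 * d h @[h --> 0^'+] --> la * (v t - u t) + lb * (w t - u t).
  move=> us vs ws ds.
  pose m h := h^-1 * a h * (v (s h) - u (s h)) + h^-1 * b h * (w (s h) - u (s h)).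
  have mc : m h @[h --> 0^'+] --> la * (v t - u t) + lb * (w t - u t).
    by apply: cvgD; apply: cvgM => //; apply: cvgB.
  have dm : h^-1 * d h - m h @[h --> 0^'+] --> 0.
    apply: (@cvg_at_right0_of_dist_le _ _ (fun h => h^-1 * r h)) => //.
    near=> h.
    have h0 : 0 < h by [].
    have [s0 ->] : 0 <= s h /\ d h = u (s h + h) - u (s h) by near: h.
    rewrite subr0 /m -!mulrA -mulrDr -mulrBr normrM gtr0_norm ?invr_gt0 //.
    by rewrite ler_pM2l ?invr_gt0 // step // ltW.
  rewrite -[X in _ --> X]add0r.
  apply: (cvg_trans _ (cvgD dm mc)); apply: near_eq_cvg; near=> h.
  by rewrite /= subrK.
apply: is_derive_two_sided.
  by apply: (quot (fun=> t)); try exact: cvg_cst; near=> h; split => //; exact: ltW.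
apply: (quot (fun h => t - h)) => //; near=> h; rewrite subrK; split => //.
rewrite subr_ge0; near: h; exact: nbhs_right_le.
Unshelve. all: by end_near. Qed.

(** * Transition probabilities of a Markov process on the integers *)

Section TransitionProbabilities.
Context (R : realType) (d : measure_display) (Omega : measurableType d).

Lemma fine_prob_split (P : probability Omega R) (E A : set Omega) :
  measurable E -> measurable A ->
  fine (P E) = fine (P (E `&` A)) + fine (P (E `&` ~` A)).
Proof.
move=> mE mA; rewrite (measureDI P mE mA) setDE addrC fineD //.
  by apply: fin_num_measure; exact: measurableI.
by apply: fin_num_measure; apply: measurableI => //; exact: measurableC.
Qed.

Lemma fine_prob_ge0 (P : probability Omega R) (A : set Omega) : 0 <= fine (P A).
Proof. exact: fine_ge0. Qed.

Lemma fine_prob_le (P : probability Omega R) (A B : set Omega) :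
  measurable A -> measurable B -> A `<=` B -> fine (P A) <= fine (P B).
Proof.
move=> mA mB AB; apply: fine_le; try exact: fin_num_measure.
by apply: le_measure; rewrite ?inE.
Qed.

Lemma fine_prob_le1 (P : probability Omega R) (A : set Omega) :
  measurable A -> fine (P A) <= 1.
Proof.
move=> mA; rewrite -[1]/(fine 1%E) -(probability_setT P).
by apply: fine_prob_le.
Qed.

Variables (Pr : int -> probability Omega R) (X : R -> Omega -> int).

Lemma at_state_disj (t : R) (i j : int) : i != j ->
  at_state X t i `&` at_state X t j = set0.
Proof.
by move/eqP=> ij; rewrite -subset0 => w [Xi Xj]; apply: ij; rewrite -Xi.
Qed.

(** Three disjoint events are split off in turn; all farther states stay lumped in one complement,
    so finite additivity is enough. *)
Lemma at_state_fine_prob_sum (P : probability Omega R) (t : R) (k : int) (E : set Omega) :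
  (forall n, measurable (at_state X t n)) -> measurable E ->
  fine (P E) = fine (P (E `&` at_state X t (k - 1))) +
    fine (P (E `&` at_state X t k)) + fine (P (E `&` at_state X t (k + 1))) +
    fine (P (E `&` ~` (at_state X t (k - 1) `|` at_state X t k
                         `|` at_state X t (k + 1)))).
Proof.
move=> mX mE; set A := at_state X t (k - 1); set B := at_state X t k.
set C := at_state X t (k + 1).
have [mA mB mC] : [/\ measurable A, measurable B & measurable C] by split; exact: mX.
have sub (S T : set Omega) : S `&` T = set0 -> S `<=` ~` T.
  by move=> ST w Sw Tw; have : (S `&` T) w by []; rewrite ST.
have BA : B `<=` ~` A by apply: sub; apply: at_state_disj; lia.
have CA : C `<=` ~` A by apply: sub; apply: at_state_disj; lia.
have CB : C `<=` ~` B by apply: sub; apply: at_state_disj; lia.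
have mEA : measurable (E `&` ~` A) by apply: measurableI => //; apply: measurableC.
have mEAB : measurable (E `&` ~` A `&` ~` B).
  by apply: measurableI => //; apply: measurableC.
rewrite (fine_prob_split P mE mA) (fine_prob_split P mEA mB).
rewrite (fine_prob_split P mEAB mC) !setCU !setIA -!addrA.
by rewrite -!(setIA E) (setIidr BA) -(setIA (~` A)) (setIidr CB) (setIidr CA).
Qed.

Definition multi_step_prob (k : int) (h : R) : R :=
  fine (Pr k (~` (at_state X h (k - 1) `|` at_state X h k
                  `|` at_state X h (k + 1)))).

Hypothesis mkv : is_markov_process Pr X.

Lemma measurable_at_state (t : R) (n : int) : 0 <= t -> measurable (at_state X t n).
Proof. by case: mkv => mX _ _; exact: mX. Qed.

Lemma trans_prob_ge0 (k n : int) (t : R) : 0 <= trans_prob Pr X k n t.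
Proof. exact: fine_prob_ge0. Qed.

Lemma trans_prob_le1 (k n : int) (t : R) : 0 <= t -> trans_prob Pr X k n t <= 1.
Proof. by move=> t0; apply: fine_prob_le1; exact: measurable_at_state. Qed.

Lemma trans_prob0 (k n : int) : trans_prob Pr X k n 0 = (n == k)%:R.
Proof.
have [_ X0 _] := mkv; rewrite /trans_prob.
have [->|nk] := eqVneq; first by rewrite X0.
have mX i : measurable (at_state X 0 i) by exact: measurable_at_state.
have := fine_prob_split (Pr k) (mX k) (mX n).
have := fine_prob_split (Pr k) (mX n) (mX k).
have := fine_prob_split (Pr k) (measurableT) (mX k).
rewrite !setTI probability_setT X0 (at_state_disj _ nk) measure0 /= add0r => e1 e2 _.
apply/eqP; rewrite eq_le trans_prob_ge0 andbT e2.
have : fine (Pr k (~` at_state X 0 k)) = 0 by lra.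
move=> z; rewrite -[leRHS]z; apply: fine_prob_le => //; last exact: measurableC.
by apply: measurableI => //; exact: measurableC.
Qed.

Lemma markov_joint_prob (k i n : int) (s t : R) : 0 <= s -> 0 <= t ->
  fine (Pr k (at_state X (s + t) n `&` at_state X s i)) =
  trans_prob Pr X k i s * trans_prob Pr X i n t.
Proof.
move=> s0 t0; have [_ _ mk] := mkv.
have hT : history X [::] = setT by rewrite -subTset => w _ e.
have mi := measurable_at_state i s0.
have := mk k i n [::] s t s0 t0; rewrite hT setTI /cond_prob.
(* The Markov property is silent on a null conditioning event; in that case both sides vanish, the
   left one by monotonicity. *)
have [Pgt0 /(_ _ isT) mkE|] := boolP (0 < Pr k (at_state X s i))%E.
  rewrite -mkE // mulrC divfK // gt_eqF //.
  by apply: fine_gt0; rewrite Pgt0 ltey_eq fin_num_measure.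
rewrite -leNgt => Ple0 _.
have P0 : trans_prob Pr X k i s = 0.
  by apply/eqP; rewrite eq_le trans_prob_ge0 andbT; apply: fine_le0.
rewrite P0 mul0r; apply/eqP; rewrite eq_le fine_prob_ge0 andbT -P0.
apply: fine_prob_le => //.
by apply: measurableI => //; apply: measurable_at_state; exact: addr_ge0.
Qed.

(** Condition on the state at the early time [h], and eliminate [trans_prob Pr X k k h] by total
    mass 1. What remains is the joint probability of a long jump and arrival in [n], minus the
    probability of a long jump times [trans_prob Pr X k n t]. Both terms lie between 0 and
    [multi_step_prob k h]. *)
Lemma trans_prob_one_step (k n : int) (t h : R) : 0 <= t -> 0 <= h ->
  `|trans_prob Pr X k n (t + h) - trans_prob Pr X k n t -
    (trans_prob Pr X k (k + 1) h * (trans_prob Pr X (k + 1) n t - trans_prob Pr X k n t) +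
     trans_prob Pr X k (k - 1) h * (trans_prob Pr X (k - 1) n t - trans_prob Pr X k n t))|
  <= multi_step_prob k h.
Proof.
move=> t0 h0; rewrite /multi_step_prob; set N := ~` _.
have mX i : measurable (at_state X h i) by exact: measurable_at_state.
have mth : measurable (at_state X (h + t) n).
  by apply: measurable_at_state; exact: addr_ge0.
have mN : measurable N by apply: measurableC; do 2 (apply: measurableU => //).
have := at_state_fine_prob_sum (Pr k) k mX mth.
rewrite !markov_joint_prob // -/N => e1.
have := at_state_fine_prob_sum (Pr k) k mX measurableT.
rewrite !setTI probability_setT -/N /= => e2.
have th0 : 0 <= fine (Pr k (at_state X (h + t) n `&` N)) by exact: fine_prob_ge0.
have thN : fine (Pr k (at_state X (h + t) n `&` N)) <= fine (Pr k N).
  by apply: fine_prob_le => //; exact: measurableI.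
have N0 := fine_prob_ge0 (Pr k) N.
have p0 := trans_prob_ge0 k n t; have p1 := trans_prob_le1 k n t0.
rewrite (addrC t) {1}/trans_prob e1.
have {e2} : trans_prob Pr X k k h = 1 - trans_prob Pr X k (k - 1) h
   - trans_prob Pr X k (k + 1) h - fine (Pr k N) by rewrite /trans_prob; lra.
move=> ->; rewrite ler_norml; apply/andP; split; nra.
Qed.

End TransitionProbabilities.

(** * The backward system and its reversal *)

Section BackwardEquation.
Context (R : realType) (d : measure_display) (Omega : measurableType d).
Variables (Pr : int -> probability Omega R) (X : R -> Omega -> int).
Variables (lam mu : int -> R).
Hypothesis bd : is_bilateral_bd_process Pr X lam mu.

Let mkv : is_markov_process Pr X. Proof. by case: bd. Qed.

(** These are the rate limits at time 0, where conditioning on the almost sure event of being in [k]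
    changes no probability. *)
Lemma trans_prob_rates (k : int) :
  [/\ h^-1 * trans_prob Pr X k (k + 1) h @[h --> 0^'+] --> lam k,
      h^-1 * trans_prob Pr X k (k - 1) h @[h --> 0^'+] --> mu k
    & h^-1 * multi_step_prob Pr X k h @[h --> 0^'+] --> 0].
Proof.
have [[_ X0 _] _ _ rates] := bd.
have cond (A : set Omega) : measurable A ->
    cond_prob (Pr k) A (at_state X 0 k) = fine (Pr k A).
  move=> mA; have mk : measurable (at_state X 0 k).
    exact: (measurable_at_state mkv).
  rewrite /cond_prob X0 divr1 (fine_prob_split (Pr k) mA mk).
  suff -> : fine (Pr k (A `&` ~` at_state X 0 k)) = 0 by rewrite addr0.
  have := fine_prob_split (Pr k) measurableT mk.
  rewrite !setTI probability_setT X0 /= => e.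
  have z : fine (Pr k (~` at_state X 0 k)) = 0 by lra.
  apply/eqP; rewrite eq_le fine_prob_ge0 andbT -[leRHS]z.
  apply: fine_prob_le => //; last exact: measurableC.
  by apply: measurableI => //; exact: measurableC.
have Xk0 : (0 < Pr k (at_state X 0 k))%E by rewrite X0.
have [rl rm re] := rates k k 0 (lexx 0) Xk0.
split; [apply: (cvg_trans _ rl)|apply: (cvg_trans _ rm)|apply: (cvg_trans _ re)];
  apply: near_eq_cvg; near=> h; rewrite add0r cond //.
- by apply: (measurable_at_state mkv).
- by apply: (measurable_at_state mkv).
- have mX i : measurable (at_state X h i) by exact: (measurable_at_state mkv).
  by apply: measurableC; do 2 (apply: measurableU => //).
Unshelve. all: by end_near. Qed.

(** A modulus of continuity for [trans_prob Pr X k n] that is uniform in time and in [n]; uniformity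
    in time makes it control increments ending at [t] too, which yields left continuity. *)
Definition step_modulus (k : int) (h : R) : R :=
  trans_prob Pr X k (k + 1) h + trans_prob Pr X k (k - 1) h + multi_step_prob Pr X k h.

Lemma step_modulus_cvg0 (k : int) : step_modulus k h @[h --> 0^'+] --> 0.
Proof.
have [/cvg_at_right0_of_quotient u0 /cvg_at_right0_of_quotient d0] := trans_prob_rates k.
move=> /cvg_at_right0_of_quotient e0.
by rewrite -[X in _ --> X]addr0 -[X in _ --> X + _]addr0; apply: cvgD => //; apply: cvgD.
Qed.

Lemma trans_prob_increment_le (k n : int) (t h : R) : 0 <= t -> 0 <= h ->
  `|trans_prob Pr X k n (t + h) - trans_prob Pr X k n t| <= step_modulus k h.
Proof.
move=> t0 h0; have := trans_prob_one_step mkv k n t0 h0.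
have a0 := trans_prob_ge0 Pr X k (k + 1) h.
have b0 := trans_prob_ge0 Pr X k (k - 1) h.
have [u0 u1] := (trans_prob_ge0 Pr X k n t, trans_prob_le1 mkv k n t0).
have [v0 v1] := (trans_prob_ge0 Pr X (k + 1) n t, trans_prob_le1 mkv (k + 1) n t0).
have [w0 w1] := (trans_prob_ge0 Pr X (k - 1) n t, trans_prob_le1 mkv (k - 1) n t0).
rewrite /step_modulus !ler_norml => /andP[lo hi].
have [va vb] : -1 <= trans_prob Pr X (k + 1) n t - trans_prob Pr X k n t <= 1 /\
  -1 <= trans_prob Pr X (k - 1) n t - trans_prob Pr X k n t <= 1 by split; lra.
by apply/andP; split; nra.
Qed.

Lemma trans_prob_right_cvg (k n : int) (t : R) : 0 <= t ->
  trans_prob Pr X k n (t + h) @[h --> 0^'+] --> trans_prob Pr X k n t.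
Proof.
move=> t0; apply: cvg_at_right0_of_dist_le (step_modulus_cvg0 k).
by near=> h; apply: trans_prob_increment_le => //; exact: ltW.
Unshelve. all: by end_near. Qed.

Lemma trans_prob_left_cvg (k n : int) (t : R) : 0 < t ->
  trans_prob Pr X k n (t - h) @[h --> 0^'+] --> trans_prob Pr X k n t.
Proof.
move=> t0; apply: cvg_at_right0_of_dist_le (step_modulus_cvg0 k).
near=> h; have th : 0 <= t - h by rewrite subr_ge0; near: h; exact: nbhs_right_le.
have h0 : 0 <= h by exact: ltW.
by have := trans_prob_increment_le k n th h0; rewrite subrK distrC.
Unshelve. all: by end_near. Qed.

Lemma trans_prob_backward (k n : int) (t : R) : 0 < t ->
  is_derive t 1 (trans_prob Pr X k n)
    (lam k * (trans_prob Pr X (k + 1) n t - trans_prob Pr X k n t) +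
     mu k * (trans_prob Pr X (k - 1) n t - trans_prob Pr X k n t)).
Proof.
move=> t0; have [up down esc] := trans_prob_rates k.
apply: (is_derive_of_one_step t0 _ up down esc); last 3 first.
- exact: trans_prob_left_cvg.
- exact: trans_prob_left_cvg.
- exact: trans_prob_left_cvg.
by move=> s h s0 h0; exact: trans_prob_one_step.
Qed.

(** The weights carry the backward coefficients [lam k], [mu k] to the forward coefficients
    [muf (k + 1)], [lamf (k - 1)], and equal total rates match the diagonal terms. Keeping two pairs
    of rates covers both plain reversal and reversal combined with the change of rates by [nu]. *)
Lemma forward_solution_of_weights (lamf muf w : int -> R) (n : int) :
  (forall k, 0 < w k) ->
  (forall k, lamf k + muf k = lam k + mu k) ->
  (forall k, w k * lam k = w (k + 1) * muf (k + 1)) ->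
  (forall k, w (k + 1) * mu (k + 1) = w k * lamf k) ->
  forward_solution lamf muf n (fun k t => w k / w n * trans_prob Pr X k n t).
Proof.
move=> w0 sum_rates wl wm; split=> [k|k|k t t0].
- rewrite (trans_prob0 mkv) eq_sym; case: eqVneq => [->|_]; last by rewrite mulr0.
  by rewrite mulr1 divff // gt_eqF.
- apply: cvgM; first exact: cvg_cst.
  have := @trans_prob_right_cvg k n 0 (lexx 0).
  by apply: cvg_trans; apply: near_eq_cvg; near=> h; rewrite add0r.
- have dk := @trans_prob_backward k n t t0.
  have dw := is_deriveZ (w k / w n) dk.
  apply: is_derive_eq dw _; rewrite /GRing.scale /=.
  have := wm (k - 1); rewrite subrK => wm1.
  have e1 : lamf (k - 1) * (w (k - 1) / w n) = w k * mu k / w n.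
    by rewrite wm1 mulrCA mulrA.
  have e2 : muf (k + 1) * (w (k + 1) / w n) = w k * lam k / w n.
    by rewrite wl mulrCA mulrA.
  rewrite (mulrA (lamf _)) e1 (mulrA (muf _)) e2 sum_rates; ring.
Unshelve. all: by end_near. Qed.

End BackwardEquation.

Unset Implicit Arguments.

Theorem theorem1 (R : realType)
    (d : measure_display) (Omega : measurableType d)
    (Pr : int -> probability Omega R) (X : R -> Omega -> int)
    (d' : measure_display) (Omega' : measurableType d')
    (Pr' : int -> probability Omega' R) (X' : R -> Omega' -> int)
    (lam mu nu : int -> R)
    (hX : is_simple_bilateral_bd_process Pr X lam mu)
    (nu_mono : strictly_monotonic nu)
    (nu_pos : forall n : int, 0 < nu n)
    (nu_rec : forall n : int,
       nu (n + 1) * lam n - nu n * (lam n + mu n) + nu (n - 1) * mu n = 0)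
    (hX' : is_bilateral_bd_process Pr' X'
       (fun n => lam n * (nu (n + 1) / nu n))
       (fun n => mu n * (nu (n - 1) / nu n))) :
  forall (k n : int) (t : R), 0 <= t ->
    trans_prob Pr' X' k n t = nu n / nu k * trans_prob Pr X k n t.
Proof.
have [bdX _ uniqX] := hX; have [_ lam0 mu0 _] := bdX.
(* [p] is the reversing measure; its ratios are forced by detailed balance. *)
have [p p0 prec] : exists2 p : int -> R, (forall n, 0 < p n) &
    forall n, p (n + 1) = lam n / mu (n + 1) * p n.
  by apply: int_recurrence_pos => n; exact: divr_gt0.
have balance n : p n * lam n = p (n + 1) * mu (n + 1).
  by rewrite prec mulrAC divfK ?gt_eqF // mulrC.
move=> k n t t0; have [_ uniq_n] := uniqX n.
have revX : p k / p n * trans_prob Pr X k n t = trans_prob Pr X n k t.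
  apply: (uniq_n (fun k t => p k / p n * trans_prob Pr X k n t)) => //.
    by apply: (forward_solution_of_weights bdX (w := p)) => // i; rewrite balance.
  by move=> i s _; rewrite mulr_ge0 ?trans_prob_ge0 // divr_ge0 // ltW.
have nuN0 i : nu i != 0 by rewrite gt_eqF.
(* The weight has one factor [nu], not two: [p i * nu i ^ 2] would lead to the forward system of the
   transformed rates, whereas [p i * nu i] leads to that of [lam], [mu], where uniqueness is
   available. *)
have revX' : p k * nu k / (p n * nu n) * trans_prob Pr' X' k n t = trans_prob Pr X n k t.
  apply: (uniq_n (fun k t => p k * nu k / (p n * nu n) * trans_prob Pr' X' k n t)) => //.
    apply: (forward_solution_of_weights hX' (w := fun i => p i * nu i)) => i /=.
    - exact: mulr_gt0.
    (* Divided by [nu i], the recurrence says that the total rate out of [i] is the same for both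
       processes. *)
    - rewrite !mulrA -mulrDl; apply: (canRL (mulfK (nuN0 i))).
      by have := nu_rec i; lra.
    - rewrite mulrACA balance; field.
      by rewrite nuN0.
    - rewrite addrK mulrACA -balance; field.
      by rewrite nuN0.
  move=> i s _; rewrite mulr_ge0 ?trans_prob_ge0 // divr_ge0 // ltW //; exact: mulr_gt0.
have pN0 i : p i != 0 by rewrite gt_eqF.
have c0 : p k * nu k / (p n * nu n) != 0 by rewrite mulf_neq0 ?invr_eq0 ?mulf_neq0.
(* Both reversals express [trans_prob Pr X n k t]; it remains to compare their constants, where [p]
   cancels. *)
apply: (mulfI c0); rewrite revX' -revX mulrA; congr (_ * _); field.
by rewrite !pN0 !nuN0.
Qed.
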